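(* Let $T>0$ and let $f,g\in C_c^\infty(0,T)$ be real-valued. Let $w^f,w^g$ be the solutions of the viscoelastic string problem with boundary deformation $f$, respectively $g$, let $y^f(t)=w^f_x(0,t)$, $y^g(t)=w^g_x(0,t)$, and put $$H(s,t)=\int_0^L w^f(x,t)\,w^g(x,s)\,dx .$$ Then for every $s,t\in(0,T)$ $$\frac{\partial}{\partial t}H(s,t)=\frac{\partial^2}{\partial s^2}\int_0^t N(t-\xi)H(s,\xi)\,d\xi-\int_0^s R(s-\nu)\left[\int_0^t N(t-\xi)\frac{\partial^2}{\partial\nu^2}H(\nu,\xi)\,d\xi\right]d\nu+F(s,t),$$ where $$F(s,t)=\frac{\partial}{\partial s}\Psi(s,t)-\int_0^s R(s-\nu)\frac{\partial}{\partial\nu}\Psi(\nu,t)\,d\nu,\qquad \Psi(s,t)=\int_0^s N(s-\sigma)\Phi(\sigma,t)\,d\sigma,$$ $$\Phi(s,t)=\int_0^t N(t-r)\left[f(r)y^g(s)-y^f(r)g(s)\right]dr .$$ Moreover $H(0,t)=H(s,0)=0$ and $H_t(s,0)=H_s(0,t)=0$ for all $s,t$.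
   Context: $L>0$; $q:[0,L]\to\mathbb{R}$ is continuous; the relaxation kernel $N$ is real-valued of class $C^3$ on $[0,\infty)$ with $N(0)=1$; $N_1=N'$. The resolvent kernel $R$ of $N_1$ is the unique solution of the Volterra equation $R(t)+\int_0^t N_1(t-s)R(s)\,ds=N_1(t)$, $t\ge 0$. Viscoelastic string problem with boundary deformation $f$: $w^f=w^f(x,t)$ is the solution of $$w_t(x,t)=\int_0^t N(t-s)\left[w_{xx}(x,s)+q(x)w(x,s)\right]ds,\qquad x\in(0,L),\ t\in(0,T),$$ with $w(x,0)=0$, $w(0,t)=f(t)$, $w(L,t)=0$. For $f\in C_c^\infty(0,T)$ this solution is classical. *)

(* Defs.v *)
From Stdlib Require Import Reals.
From Coquelicot Require Import Coquelicot.
Open Scope R_scope.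

(** Derivative of [f] at [x] relative to [D]: this is [is_derive] with [locally x]
    replaced by its trace on [D]. At interior points of [D] it is the ordinary
    derivative, at an endpoint of an interval it is the one-sided one. *)
Definition is_derive_within (D : R -> Prop) (f : R -> R) (x l : R) : Prop :=
  filterdiff f (within D (locally x)) (fun h => scal h l).

Definition nonneg_half_line (t : R) : Prop := 0 <= t.
Definition space_interval (L x : R) : Prop := 0 <= x <= L.
Definition time_interval (T t : R) : Prop := 0 <= t < T.

Definition continuous_on_cylinder (L T : R) (u : R -> R -> R) : Prop :=
  continuous_on
    (fun p : R * R => space_interval L (fst p) /\ time_interval T (snd p))
    (fun p : R * R => u (fst p) (snd p)).

Definition C_k_on (D : R -> Prop) (k : nat) (f : R -> R) : Prop :=
  exists d : nat -> R -> R,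
    (forall x, D x -> d 0%nat x = f x) /\
    (forall j x, (j < k)%nat -> D x -> is_derive_within D (d j) x (d (S j) x)) /\
    (forall j, (j <= k)%nat -> continuous_on D (d j)).

(** [C_c^\infty(0,T)], its elements being extended by zero to the whole line. *)
Definition test_function (T : R) (f : R -> R) : Prop :=
  (forall n t, ex_derive_n f n t) /\
  exists a b, 0 < a /\ b < T /\ forall t, f t <> 0 -> a <= t <= b.

(** The resolvent is sought among the continuous functions on the half-line,
    where the Volterra equation has exactly one solution. *)
Definition is_resolvent (N1 Res : R -> R) : Prop :=
  continuous_on nonneg_half_line Res /\
  forall t, 0 <= t ->
    Res t + RInt (fun s => N1 (t - s) * Res s) 0 t = N1 t.

(** [w] is a classical solution with boundary deformation [f]: [w] and the
    derivatives occurring in the equation are continuous up to the boundary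
    of [(0,L) x (0,T)], except possibly at time [T]. Values of [w] outside
    [[0,L] x [0,T)] are irrelevant. *)
Definition classical_solution (L T : R) (q N f : R -> R) (w : R -> R -> R) : Prop :=
  exists wt wx wxx : R -> R -> R,
    continuous_on_cylinder L T w /\
    continuous_on_cylinder L T wt /\
    continuous_on_cylinder L T wx /\
    continuous_on_cylinder L T wxx /\
    (forall x t, space_interval L x -> time_interval T t ->
       is_derive_within (time_interval T) (fun t' => w x t') t (wt x t) /\
       is_derive_within (space_interval L) (fun x' => w x' t) x (wx x t) /\
       is_derive_within (space_interval L) (fun x' => wx x' t) x (wxx x t)) /\
    (forall x t, 0 < x < L -> 0 < t < T ->
       wt x t = RInt (fun s => N (t - s) * (wxx x s + q x * w x s)) 0 t) /\
    (forall x, 0 < x < L -> w x 0 = 0) /\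
    (forall t, 0 < t < T -> w 0 t = f t) /\
    (forall t, 0 < t < T -> w L t = 0).

(** [y t = w_x(0,t)], the derivative being taken from inside the string. *)
Definition is_boundary_slope (L T : R) (w : R -> R -> R) (y : R -> R) : Prop :=
  forall t, 0 < t < T ->
    is_derive_within (space_interval L) (fun x => w x t) 0 (y t).

(** First argument [s] is the time of [w^g], second argument [t] that of [w^f]. *)
Definition H_of (L : R) (wf wg : R -> R -> R) (s t : R) : R :=
  RInt (fun x => wf x t * wg x s) 0 L.

Definition Phi_of (N f g yf yg : R -> R) (s t : R) : R :=
  RInt (fun r => N (t - r) * (f r * yg s - yf r * g s)) 0 t.

Definition Psi_of (N : R -> R) (Phi : R -> R -> R) (s t : R) : R :=
  RInt (fun sigma => N (s - sigma) * Phi sigma t) 0 s.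

Definition F_of (Res : R -> R) (Psi : R -> R -> R) (s t : R) : R :=
  Derive (fun s' => Psi s' t) s
  - RInt (fun nu => Res (s - nu) * Derive (fun nu' => Psi nu' t) nu) 0 s.

(** [Derive], [Derive_n] and [RInt] are total; this predicate says that every
    derivative and every integral in the identity at [(s,t)] exists. The
    two-sided [nu]-derivatives under an integral over [(0,s)] may have
    meaningless values at [nu = 0], which affect neither existence nor value of
    the integral; likewise for [xi = 0], [sigma = 0] and [r = 0]. *)
Definition terms_exist (L : R) (N Res f g yf yg : R -> R) (wf wg : R -> R -> R)
    (s t : R) : Prop :=
  let H := H_of L wf wg in
  let Phi := Phi_of N f g yf yg in
  let Psi := Psi_of N Phi in
  ex_RInt (fun x => wf x t * wg x s) 0 L /\
  ex_derive (fun t' => H s t') t /\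
  ex_RInt (fun xi => N (t - xi) * H s xi) 0 t /\
  (forall k, (k <= 2)%nat ->
     ex_derive_n (fun s' => RInt (fun xi => N (t - xi) * H s' xi) 0 t) k s) /\
  (forall k, (k <= 2)%nat -> ex_derive_n (fun s' => H s' t) k s) /\
  ex_RInt (fun xi => N (t - xi) * Derive_n (fun nu => H nu xi) 2 s) 0 t /\
  ex_RInt (fun nu => Res (s - nu) *
     RInt (fun xi => N (t - xi) * Derive_n (fun nu' => H nu' xi) 2 nu) 0 t) 0 s /\
  ex_RInt (fun r => N (t - r) * (f r * yg s - yf r * g s)) 0 t /\
  ex_RInt (fun sigma => N (s - sigma) * Phi sigma t) 0 s /\
  ex_derive (fun s' => Psi s' t) s /\
  ex_RInt (fun nu => Res (s - nu) * Derive (fun nu' => Psi nu' t) nu) 0 s.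

(* Main.v *)
Require Import Defs.
From Stdlib Require Import Reals Lra Lia ClassicalEpsilon.
From Coquelicot Require Import Coquelicot.
Open Scope R_scope.

(** Write [a = w_xx + q w], so that the equation reads [w_t = N * a] with [*] the
    convolution in time. Then [H_t(s,t)] is [N *_t] the integral over [(0,L)] of
    [a^f(x,.) w^g(x,s)], and Green's formula moves the operator onto [w^g] at the
    price of the boundary term [Phi]: [H_t = Phi + j] with [j = N *_t J] and [J(s,xi)]
    the integral of [w^f(x,xi) a^g(x,s)]. Differentiating the equation gives
    [w_tt = a + N1 * a], hence [(N *_t H)_ss = j + N1 *_s j], and [Psi = N *_s Phi] gives
    [Psi_s = Phi + N1 *_s Phi]. The resolvent inverts both: [v = a + N1 * a] implies
    [v - Res * v = a].

    One-sided regularity at the ends of the intervals is dealt with once and for all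
    by replacing the data by functions continuous on the whole line or plane, which
    agree with them up to a time [b < T]. *)

(** * Continuity of functions and of integrals depending on parameters *)

Definition continuous1 (f : R -> R) : Prop := forall x, continuous f x.
Definition continuous2 (h : R -> R -> R) : Prop :=
  forall p : R * R, continuous (fun z : R * R => h (fst z) (snd z)) p.

Lemma continuous_Rplus {U : UniformSpace} (f g : U -> R) (z : U) :
  continuous f z -> continuous g z -> continuous (fun u => f u + g u) z.
Proof. intros Hf Hg. exact (continuous_plus f g z Hf Hg). Qed.

Lemma continuous_Rminus {U : UniformSpace} (f g : U -> R) (z : U) :
  continuous f z -> continuous g z -> continuous (fun u => f u - g u) z.
Proof. intros Hf Hg. exact (continuous_minus f g z Hf Hg). Qed.

Lemma continuous_Rmult {U : UniformSpace} (f g : U -> R) (z : U) :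
  continuous f z -> continuous g z -> continuous (fun u => f u * g u) z.
Proof. intros Hf Hg. exact (continuous_mult f g z Hf Hg). Qed.

Lemma continuous_fst_comp {U V W : UniformSpace} (f : U -> V * W) (z : U) :
  continuous f z -> continuous (fun u => fst (f u)) z.
Proof.
  intros Hf. apply (continuous_comp f fst); [exact Hf|].
  destruct (f z); apply continuous_fst.
Qed.

Lemma continuous_snd_comp {U V W : UniformSpace} (f : U -> V * W) (z : U) :
  continuous f z -> continuous (fun u => snd (f u)) z.
Proof.
  intros Hf. apply (continuous_comp f snd); [exact Hf|].
  destruct (f z); apply continuous_snd.
Qed.

Lemma continuous1_comp {U : UniformSpace} (A : R -> R) (f : U -> R) (z : U) :
  continuous1 A -> continuous f z -> continuous (fun u => A (f u)) z.
Proof. intros HA Hf. apply (continuous_comp f A); [exact Hf | apply HA]. Qed.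

Lemma continuous2_comp {U : UniformSpace} (h : R -> R -> R) (f g : U -> R) (z : U) :
  continuous2 h -> continuous f z -> continuous g z ->
  continuous (fun u => h (f u) (g u)) z.
Proof.
  intros Hh Hf Hg. apply (continuous_comp_2 f g h); [exact Hf | exact Hg | apply Hh].
Qed.

(** By compactness of [[a, b]], [h p] tends to [h p0] uniformly there as [p] tends to [p0], and
    integration commutes with uniform limits. The parameter space [U] is arbitrary because nested
    integrals turn it into an iterated product. *)
Lemma continuous_RInt_param {U : UniformSpace} (h : U -> R -> R) (a b : R) (p0 : U) :
  a <= b ->
  (forall z : U * R, continuous (fun z : U * R => h (fst z) (snd z)) z) ->
  continuous (fun p => RInt (h p) a b) p0.
Proof.
  intros Hab Hh.
  (* [filterlim_RInt] asks for uniform convergence on the whole line. Composing with the retraction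
     [cl] onto [[a, b]] provides it without changing the integrals. *)
  set (cl := fun y => Rmax a (Rmin b y)).
  assert (Hcl : forall y, a <= cl y <= b).
  { intros y. unfold cl. split; [apply Rmax_l|]. apply Rmax_lub; [exact Hab | apply Rmin_l]. }
  assert (Hcl' : forall y, a <= y <= b -> cl y = y).
  { intros y [H1 H2]. unfold cl. rewrite (Rmin_right b y) by exact H2.
    apply Rmax_right; exact H1. }
  assert (Hhp : forall p y, continuous (h p) y).
  { intros p y. apply (continuous_comp_2 (fun _ => p) (fun y => y) h).
    - apply continuous_const.
    - apply continuous_id.
    - apply Hh. }
  assert (Hext : forall p, is_RInt (fun y => h p (cl y)) a b (RInt (h p) a b)).
  { intros p. apply (is_RInt_ext (h p)).
    - intros y Hy. rewrite Rmin_left, Rmax_right in Hy by exact Hab.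
      rewrite Hcl' by lra. reflexivity.
    - apply (RInt_correct (V := R_CompleteNormedModule)), (ex_RInt_continuous (V := R_CompleteNormedModule)). intros y _. apply Hhp. }
  destruct (filterlim_RInt (fun p y => h p (cl y)) a b (locally p0) _
              (fun y => h p0 (cl y)) (fun p => RInt (h p) a b)) as [I [HI1 HI2]].
  - exact Hext.
  - apply filterlim_locally. intros eps.
    assert (Hd : forall t, exists d : posreal, forall p y,
      ball p0 d p -> Rabs (y - t) < d -> Rabs (h p y - h p0 t) < eps / 2).
    { intros t.
      assert (He : 0 < eps / 2) by (generalize (cond_pos eps); lra).
      destruct (proj1 (filterlim_locally _ _) (Hh (p0, t)) (mkposreal _ He)) as [d Hd].
      exists d. intros p y Hp Hy. apply (Hd (p, y)). split; [exact Hp | exact Hy]. }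
    (* The compactness lemma takes the radii as a function of the centre, so they are selected by
       choice. *)
    set (delta := fun t => proj1_sig (constructive_indefinite_description _ (Hd t))).
    assert (Hdelta : forall t p y, ball p0 (delta t) p -> Rabs (y - t) < delta t ->
              Rabs (h p y - h p0 t) < eps / 2).
    { intros t. unfold delta.
      destruct (constructive_indefinite_description _ (Hd t)) as [d Hdt]. exact Hdt. }
    destruct (compactness_value_1d a b delta) as [d Hc].
    exists d. intros p Hp y.
    (* The centre [t] near [cl y] is given only under a double negation, hence the argument by
       contradiction. *)
    apply Rnot_ge_lt. intros Hge. apply (Hc (cl y) (Hcl y)).
    intros [t [Ht1 [Ht2 Ht3]]].
    assert (E1 := Hdelta t p (cl y) (ball_le _ _ _ Ht3 _ Hp) Ht2).
    assert (E2 := Hdelta t p0 (cl y) (ball_center _ _) Ht2).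
    revert Hge. apply Rlt_not_ge.
    change (Rabs (h p (cl y) - h p0 (cl y)) < eps).
    replace (h p (cl y) - h p0 (cl y))
      with ((h p (cl y) - h p0 t) - (h p0 (cl y) - h p0 t)) by ring.
    eapply Rle_lt_trans; [apply Rabs_triang|]. rewrite Rabs_Ropp. lra.
  - unfold continuous.
    rewrite <- (is_RInt_unique _ _ _ _ HI2) in HI1.
    rewrite (is_RInt_unique _ _ _ _ (Hext p0)) in HI1. exact HI1.
Qed.

(* The substitution [y = b u] reduces a moving upper bound to fixed bounds. *)
Lemma continuous_RInt_param_bound {U : UniformSpace} (h : U -> R -> R) (b : U -> R) (p0 : U) :
  (forall z : U * R, continuous (fun z : U * R => h (fst z) (snd z)) z) ->
  (forall p, continuous b p) ->
  continuous (fun p => RInt (h p) 0 (b p)) p0.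
Proof.
  intros Hh Hb.
  apply (continuous_ext (fun p => RInt (fun u => b p * h p (b p * u)) 0 1)).
  - intros p.
    assert (Hhp : forall y, continuous (h p) y).
    { intros y. apply (continuous_comp_2 (fun _ => p) (fun y => y) h).
      - apply continuous_const.
      - apply continuous_id.
      - apply Hh. }
    transitivity (RInt (fun u => scal (b p) (h p (b p * u + 0))) 0 1).
    { apply RInt_ext. intros u _. rewrite Rplus_0_r. reflexivity. }
    rewrite (RInt_comp_lin (V := R_CompleteNormedModule) (h p)).
    + f_equal; ring.
    + apply (ex_RInt_continuous (V := R_CompleteNormedModule)). intros; apply Hhp.
  - apply (continuous_RInt_param (fun p u => b p * h p (b p * u))); [lra|].
    intros z.
    assert (Hbz : continuous (fun z : U * R => b (fst z)) z).
    { apply (continuous_comp fst b); [destruct z; apply continuous_fst | apply Hb]. }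
    apply continuous_Rmult; [exact Hbz|].
    apply (continuous_comp_2 fst (fun z : U * R => b (fst z) * snd z) h).
    + destruct z; apply continuous_fst.
    + apply continuous_Rmult; [exact Hbz|]. destruct z; apply continuous_snd.
    + apply Hh.
Qed.

(** The rules follow the syntax of the function. The first one serves partial applications [h c],
    whose last variable has been eta-reduced away. *)
Ltac cont := intros; cbv beta;
  lazymatch goal with
  | H : continuous2 ?h |- continuous (?h ?c) _ =>
      apply (continuous2_comp h (fun _ => c) (fun z => z)); [exact H | cont | cont]
  | |- continuous (fun z => z) _ => apply continuous_id
  | |- continuous (fun _ => ?c) _ => apply continuous_const
  | |- continuous (fun z => fst (@?f z)) _ => apply (continuous_fst_comp f); cont
  | |- continuous (fun z => snd (@?f z)) _ => apply (continuous_snd_comp f); cont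
  | |- continuous (fun z => @?f z + @?g z) _ => apply (continuous_Rplus f g); cont
  | |- continuous (fun z => @?f z - @?g z) _ => apply (continuous_Rminus f g); cont
  | |- continuous (fun z => @?f z * @?g z) _ => apply (continuous_Rmult f g); cont
  | |- continuous (fun z => RInt (@?h z) 0 (@?b z)) _ =>
      apply (continuous_RInt_param_bound h b); cont
  | H : continuous2 ?h |- continuous (fun z => ?h (@?f z) (@?g z)) _ =>
      apply (continuous2_comp h f g); [exact H | cont | cont]
  | H : continuous1 ?A |- continuous (fun z => ?A (@?f z)) _ =>
      apply (continuous1_comp A f); [exact H | cont]
  | H : continuous1 ?A |- continuous ?A _ => apply H
  | |- continuous1 _ => unfold continuous1; cont
  | |- continuous2 _ => unfold continuous2; cont
  end.

(** * Differentiation of integrals and exchange of the order of integration *)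

Lemma ex_RInt_continuous1 (f : R -> R) (a b : R) : continuous1 f -> ex_RInt f a b.
Proof. intros Hf. apply (ex_RInt_continuous (V := R_CompleteNormedModule)). intros; apply Hf. Qed.

Lemma continuity_2d_pt_continuous2 (h : R -> R -> R) (x y : R) :
  continuous2 h -> continuity_2d_pt h x y.
Proof. intros Hh. apply continuity_2d_pt_filterlim. exact (Hh (x, y)). Qed.

Lemma is_derive_Rmult (f g : R -> R) (x df dg : R) :
  is_derive f x df -> is_derive g x dg ->
  is_derive (fun x => f x * g x) x (df * g x + f x * dg).
Proof. intros Hf Hg. apply (is_derive_mult f g x); [exact Hf | exact Hg | exact Rmult_comm]. Qed.

Lemma is_derive_RInt_upper (f : R -> R) (a t : R) :
  continuous1 f -> is_derive (fun t => RInt f a t) t (f t).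
Proof.
  intros Hf. apply (is_derive_RInt f (fun t => RInt f a t) a).
  - apply filter_forall. intros x. apply (RInt_correct (V := R_CompleteNormedModule)), ex_RInt_continuous1, Hf.
  - apply Hf.
Qed.

Lemma is_derive_RInt_under (h dh : R -> R -> R) (a b x : R) :
  (forall x y, is_derive (fun u => h u y) x (dh x y)) ->
  continuous2 h -> continuous2 dh ->
  is_derive (fun u => RInt (h u) a b) x (RInt (dh x) a b).
Proof.
  intros Hd Hh Hdh.
  assert (E : forall x y, Derive (fun u => h u y) x = dh x y).
  { intros u y. apply is_derive_unique, Hd. }
  replace (RInt (dh x) a b) with (RInt (fun t => Derive (fun u => h u t) x) a b).
  - apply (is_derive_RInt_param h).
    + apply filter_forall. intros u y _. eexists; apply Hd.
    + intros y _. apply (continuity_2d_pt_ext dh); [intros; symmetry; apply E|].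
      apply continuity_2d_pt_continuous2, Hdh.
    + apply filter_forall. intros u. apply ex_RInt_continuous1. cont.
  - apply RInt_ext. intros; apply E.
Qed.

Lemma is_derive_RInt_under_upper (h dh : R -> R -> R) (t : R) :
  (forall x y, is_derive (fun u => h u y) x (dh x y)) ->
  continuous2 h -> continuous2 dh ->
  is_derive (fun t => RInt (h t) 0 t) t (h t t + RInt (dh t) 0 t).
Proof.
  intros Hd Hh Hdh.
  assert (E : forall x y, Derive (fun u => h u y) x = dh x y).
  { intros u y. apply is_derive_unique, Hd. }
  replace (h t t + RInt (dh t) 0 t)
    with (RInt (fun y => Derive (fun u => h u y) t) 0 t + h t t * 1).
  - assert (Hi : forall u a b, ex_RInt (fun y => h u y) a b).
    { intros u a b. apply ex_RInt_continuous1. cont. }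
    assert (Hc : forall x y, continuity_2d_pt (fun u v => Derive (fun z => h z v) u) x y).
    { intros x y. apply (continuity_2d_pt_ext dh); [intros; symmetry; apply E|].
      apply continuity_2d_pt_continuous2, Hdh. }
    apply (is_derive_RInt_param_bound_comp_aux3 h 0 (fun t => t) t 1).
    + apply filter_forall. intros; apply Hi.
    + exists (mkposreal 1 Rlt_0_1). apply filter_forall. intros; apply Hi.
    + apply @is_derive_id.
    + exists (mkposreal 1 Rlt_0_1). apply filter_forall. intros u y _. eexists; apply Hd.
    + intros; apply Hc.
    + exists (mkposreal 1 Rlt_0_1). intros; apply Hc.
    + apply continuity_pt_filterlim. change (continuous (fun y => h t y) t). cont.
  - rewrite Rmult_1_r, Rplus_comm. f_equal. apply RInt_ext. intros; apply E.
Qed.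

Lemma eq_of_is_derive (F G d : R -> R) (t : R) :
  (forall t, is_derive F t (d t)) -> (forall t, is_derive G t (d t)) ->
  F 0 = G 0 -> F t = G t.
Proof.
  intros HF HG E0.
  assert (HD : forall t, is_derive (fun t => F t - G t) t zero).
  { intros u. evar_last; [apply @is_derive_minus; [apply HF | apply HG]|].
    apply @minus_eq_zero. }
  assert (E : F t - G t = F 0 - G 0).
  { destruct (Rtotal_order t 0) as [Ht | [-> | Ht]].
    - apply (eq_is_derive (fun t => F t - G t) t 0); [intros; apply HD | exact Ht].
    - reflexivity.
    - symmetry. apply (eq_is_derive (fun t => F t - G t) 0 t); [intros; apply HD | exact Ht]. }
  lra.
Qed.

Lemma RInt_const0 (a b : R) : RInt (fun _ : R => 0) a b = 0.
Proof. rewrite RInt_const. apply Rmult_0_r. Qed.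

(** As functions of the bound [a], both sides vanish at 0 and have derivative [RInt (h a) 0 b]. *)
Lemma RInt_swap (h : R -> R -> R) (a b : R) :
  continuous2 h ->
  RInt (fun x => RInt (fun y => h x y) 0 b) 0 a =
  RInt (fun y => RInt (fun x => h x y) 0 a) 0 b.
Proof.
  intros Hh.
  apply (eq_of_is_derive (fun a => RInt (fun x => RInt (fun y => h x y) 0 b) 0 a)
           (fun a => RInt (fun y => RInt (fun x => h x y) 0 a) 0 b)
           (fun a => RInt (fun y => h a y) 0 b)).
  - intros t. apply (is_derive_RInt_upper (fun x => RInt (fun y => h x y) 0 b)). cont.
  - intros t. apply (is_derive_RInt_under (fun a y => RInt (fun x => h x y) 0 a) h).
    + intros x y. apply (is_derive_RInt_upper (fun x => h x y)). cont.
    + cont.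
    + exact Hh.
  - rewrite RInt_point. symmetry.
    transitivity (RInt (fun _ : R => 0) 0 b).
    + apply RInt_ext. intros y _. exact (RInt_point 0 _).
    + apply RInt_const0.
Qed.

(** Dirichlet's formula. With the inner integral over [[r, t]] written as a difference of integrals
    from 0, both sides have the same derivative in [t]: the contribution of the moving bound is the
    inner integral at [r = t], which is zero. *)
Lemma RInt_triangle (h : R -> R -> R) (t : R) :
  continuous2 h ->
  RInt (fun s => RInt (fun r => h s r) 0 s) 0 t =
  RInt (fun r => RInt (fun s => h s r) r t) 0 t.
Proof.
  intros Hh.
  assert (Ch : forall r a b, ex_RInt (fun s => h s r) a b).
  { intros r a b. apply ex_RInt_continuous1. cont. }
  transitivity
    (RInt (fun r => RInt (fun s => h s r) 0 t - RInt (fun s => h s r) 0 r) 0 t).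
  - apply (eq_of_is_derive (fun t => RInt (fun s => RInt (fun r => h s r) 0 s) 0 t)
      (fun t => RInt (fun r => RInt (fun s => h s r) 0 t - RInt (fun s => h s r) 0 r) 0 t)
      (fun t => RInt (fun r => h t r) 0 t)).
    + intros u. apply (is_derive_RInt_upper (fun s => RInt (fun r => h s r) 0 s)). cont.
    + intros u.
      replace (RInt (fun r => h u r) 0 u)
        with ((RInt (fun s => h s u) 0 u - RInt (fun s => h s u) 0 u)
              + RInt (fun r => h u r) 0 u) by ring.
      apply (is_derive_RInt_under_upper
        (fun t r => RInt (fun s => h s r) 0 t - RInt (fun s => h s r) 0 r) h).
      * intros x y. replace (h x y) with (minus (h x y) zero) by apply minus_zero_r.
        apply @is_derive_minus; [|apply @is_derive_const].
        apply (is_derive_RInt_upper (fun s => h s y)). cont.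
      * cont.
      * exact Hh.
    + rewrite !RInt_point. reflexivity.
  - apply RInt_ext. intros r _.
    rewrite <- (RInt_Chasles (fun s => h s r) 0 r t) by apply Ch.
    unfold plus; simpl; ring.
Qed.

(** * Convolution on the half-line and the resolvent *)

Definition conv (A a : R -> R) (t : R) : R := RInt (fun s => A (t - s) * a s) 0 t.

(** The moving bound contributes [A 0 * a t]. For [A = N] with [N 0 = 1] this term is [a t], so that
    differentiating [N * a] gives a Volterra expression of the second kind, to which the resolvent
    applies. *)
Lemma is_derive_conv (A A' a : R -> R) (t : R) :
  (forall t, is_derive A t (A' t)) -> continuous1 A' -> continuous1 a ->
  is_derive (conv A a) t (A 0 * a t + conv A' a t).
Proof.
  intros HA HA' Ha.
  assert (CA : continuous1 A).
  { intros x. apply @ex_derive_continuous. eexists; apply HA. }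
  replace (A 0) with (A (t - t)) by (f_equal; ring).
  apply (is_derive_RInt_under_upper (fun t s => A (t - s) * a s)
           (fun t s => A' (t - s) * a s)).
  - intros x y. evar_last.
    + apply (is_derive_Rmult (fun u => A (u - y)) (fun _ => a y)).
      * apply (is_derive_comp A (fun u => u - y)); [apply HA|].
        apply @is_derive_minus; [apply @is_derive_id | apply @is_derive_const].
      * apply @is_derive_const.
    + unfold minus, plus, opp, scal, one, zero; simpl. unfold mult, plus; simpl. ring.
  - cont.
  - cont.
Qed.

Lemma RInt_reflect (k : R -> R) (r t : R) :
  continuous1 k -> RInt k r t = RInt (fun u => k (t - u)) 0 (t - r).
Proof.
  intros Hk.
  assert (E := RInt_comp_lin (V := R_CompleteNormedModule) k (-1) t 0 (t - r)
                 (ex_RInt_continuous1 _ _ _ Hk)).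
  replace (-1 * 0 + t) with t in E by ring.
  replace (-1 * (t - r) + t) with r in E by ring.
  rewrite <- (opp_RInt_swap (V := R_CompleteNormedModule) k)
    by apply ex_RInt_continuous1, Hk.
  rewrite <- E, <- (RInt_opp (V := R_CompleteNormedModule)).
  - apply RInt_ext. intros u _. unfold scal, opp; simpl; unfold mult; simpl.
    replace (-1 * u + t) with (t - u) by ring. ring.
  - apply ex_RInt_continuous1. unfold scal; simpl; unfold mult; simpl. cont.
Qed.

(** After exchanging the integrals over the triangle, the substitution [u = t - s] turns the inner
    one into [conv B A (t - r)]. The kernels thus come out interchanged, so that [Res * (N1 * a)]
    becomes [(N1 * Res) * a], the form in which the Volterra equation applies. *)
Lemma conv_conv (A B a : R -> R) (t : R) :
  continuous1 A -> continuous1 B -> continuous1 a ->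
  conv A (conv B a) t = conv (conv B A) a t.
Proof.
  intros HA HB Ha. unfold conv at 1 2.
  transitivity (RInt (fun s => RInt (fun r => A (t - s) * (B (s - r) * a r)) 0 s) 0 t).
  { apply RInt_ext. intros s _. symmetry. apply (RInt_scal (fun r => B (s - r) * a r)).
    apply ex_RInt_continuous1. cont. }
  rewrite (RInt_triangle (fun s r => A (t - s) * (B (s - r) * a r))) by cont.
  apply RInt_ext. intros r _.
  transitivity (RInt (fun s => scal (a r) (B (s - r) * A (t - s))) r t).
  { apply RInt_ext. intros s _. unfold scal; simpl; unfold mult; simpl; ring. }
  rewrite (RInt_scal (fun s => B (s - r) * A (t - s)))
    by (apply ex_RInt_continuous1; cont).
  unfold scal; simpl; unfold mult; simpl. rewrite Rmult_comm. f_equal. unfold conv.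
  rewrite (RInt_reflect (fun s => B (s - r) * A (t - s))) by cont.
  apply RInt_ext. intros u _. f_equal; f_equal; ring.
Qed.

Lemma conv_plus (A a c : R -> R) (t : R) :
  continuous1 A -> continuous1 a -> continuous1 c ->
  conv A (fun s => a s + c s) t = conv A a t + conv A c t.
Proof.
  intros HA Ha Hc. unfold conv.
  rewrite <- (RInt_plus (V := R_CompleteNormedModule)
    (fun s => A (t - s) * a s) (fun s => A (t - s) * c s))
    by (apply ex_RInt_continuous1; cont).
  apply RInt_ext. intros s _. unfold plus; simpl. ring.
Qed.

(** By associativity and [N1 * Res = N1 - Res], one has [Res * (a + N1 * a) = Res * a + (N1 - Res) *
    a = N1 * a]. *)
Lemma resolvent_inverse (N1 Res a : R -> R) (t : R) :
  continuous1 N1 -> continuous1 Res -> continuous1 a ->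
  (forall t, 0 <= t -> Res t + conv N1 Res t = N1 t) -> 0 <= t ->
  a t + conv N1 a t - conv Res (fun s => a s + conv N1 a s) t = a t.
Proof.
  intros HN HR Ha Hres Ht.
  assert (CR : forall s, 0 <= s -> conv N1 Res s = N1 s - Res s).
  { intros s Hs. rewrite <- (Hres s Hs). ring. }
  rewrite conv_plus; [|assumption|assumption|unfold conv; cont].
  rewrite (conv_conv Res N1 a) by assumption.
  assert (E2 : conv (conv N1 Res) a t = conv N1 a t - conv Res a t).
  { unfold conv at 1 3 4. rewrite <- (RInt_minus (V := R_CompleteNormedModule)
      (fun s => N1 (t - s) * a s) (fun s => Res (t - s) * a s)).
    - apply RInt_ext. intros s Hs. rewrite Rmin_left, Rmax_right in Hs by exact Ht.
      rewrite CR by lra. unfold minus, plus, opp; simpl. ring.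
    - apply ex_RInt_continuous1. cont.
    - apply ex_RInt_continuous1. cont. }
  rewrite E2. ring.
Qed.

(** * Derivatives relative to a set *)

(** [filterdiff] demands its estimate at every limit point of the filter. As [x] lies in [D], the
    trace of [locally x] on [D] has no limit point other than [x], which leaves the epsilon-delta
    form. *)
Lemma is_derive_within_spec (D : R -> Prop) (f : R -> R) (x l : R) :
  D x ->
  (is_derive_within D f x l <->
   forall eps : posreal, exists d : posreal, forall y, Rabs (y - x) < d -> D y ->
     Rabs (f y - f x - (y - x) * l) <= eps * Rabs (y - x)).
Proof.
  intros Dx. split.
  - intros [_ H] eps.
    assert (Hx : is_filter_lim (within D (locally x)) x).
    { intros P HP. apply (filter_imp (F := locally x) P); [tauto | exact HP]. }
    destruct (H x Hx eps) as [d Hd]. exists d. exact Hd.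
  - intros H. split; [exact (is_linear_scal_l (V := R_NormedModule) l)|].
    intros x' Hx'.
    assert (E : x' = x).
    { destruct (Req_dec x' x) as [E | E]; [exact E|].
      assert (Hr : 0 < Rabs (x - x')) by (apply Rabs_pos_lt; lra).
      assert (HB := locally_singleton _ _
        (Hx' _ (locally_ball x' (mkposreal _ Hr))) Dx).
      exfalso. exact (Rlt_irrefl _ HB). }
    rewrite E. intros eps. destruct (H eps) as [d Hd]. exists d. exact Hd.
Qed.

Lemma is_derive_spec (f : R -> R) (x l : R) :
  is_derive f x l <->
  forall eps : posreal, exists d : posreal, forall y, Rabs (y - x) < d ->
    Rabs (f y - f x - (y - x) * l) <= eps * Rabs (y - x).
Proof.
  split.
  - intros [_ H] eps.
    assert (Hx : is_filter_lim (locally x) x) by (intros P HP; exact HP).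
    destruct (H x Hx eps) as [d Hd]. exists d. exact Hd.
  - intros H. split; [exact (is_linear_scal_l (V := R_NormedModule) l)|].
    intros x' Hx'.
    rewrite <- (is_filter_lim_locally_unique _ _ Hx').
    intros eps. destruct (H eps) as [d Hd]. exists d. exact Hd.
Qed.

(** The points [x + h] with small [h > 0] lie in [D]. If the slopes differed, the two estimates with
    error [|l1 - l2| / 4] would give [h |l1 - l2| <= h |l1 - l2| / 2] there. *)
Lemma is_derive_within_unique (D : R -> Prop) (f : R -> R) (x b l1 l2 : R) :
  x < b -> (forall y, x <= y < b -> D y) ->
  is_derive_within D f x l1 -> is_derive_within D f x l2 -> l1 = l2.
Proof.
  intros Hb HD H1 H2.
  assert (Dx : D x) by (apply HD; lra).
  rewrite (is_derive_within_spec D f x l1 Dx) in H1.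
  rewrite (is_derive_within_spec D f x l2 Dx) in H2.
  destruct (Req_dec l1 l2) as [E | E]; [exact E | exfalso].
  assert (Hl : 0 < Rabs (l1 - l2)) by (apply Rabs_pos_lt; lra).
  assert (He : 0 < Rabs (l1 - l2) / 4) by lra.
  destruct (H1 (mkposreal _ He)) as [d1 Hd1]. destruct (H2 (mkposreal _ He)) as [d2 Hd2].
  simpl in Hd1, Hd2.
  set (h := Rmin (Rmin d1 d2) (b - x) / 2).
  assert (Hh : 0 < h < d1 /\ h < d2 /\ h < b - x).
  { assert (0 < Rmin (Rmin d1 d2) (b - x)).
    { repeat apply Rmin_glb_lt; try apply cond_pos. lra. }
    assert (A1 := Rmin_l (Rmin d1 d2) (b - x)). assert (A2 := Rmin_r (Rmin d1 d2) (b - x)).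
    assert (A3 := Rmin_l d1 d2). assert (A4 := Rmin_r d1 d2).
    unfold h. lra. }
  assert (Eh : x + h - x = h) by ring.
  specialize (Hd1 (x + h)). specialize (Hd2 (x + h)). rewrite Eh in Hd1, Hd2.
  rewrite (Rabs_pos_eq h) in Hd1, Hd2 by lra.
  assert (B1 := Hd1 ltac:(lra) ltac:(apply HD; lra)).
  assert (B2 := Hd2 ltac:(lra) ltac:(apply HD; lra)).
  assert (B : Rabs (h * (l1 - l2)) <= Rabs (l1 - l2) / 4 * h + Rabs (l1 - l2) / 4 * h).
  { replace (h * (l1 - l2))
      with ((f (x + h) - f x - h * l2) - (f (x + h) - f x - h * l1)) by ring.
    eapply Rle_trans; [apply Rabs_triang|]. rewrite Rabs_Ropp. lra. }
  rewrite Rabs_mult, (Rabs_pos_eq h) in B by lra. nra.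
Qed.

Lemma is_derive_within_interior (D : R -> Prop) (f : R -> R) (x l : R) :
  locally x D -> is_derive_within D f x l -> is_derive f x l.
Proof.
  intros HD H. apply is_derive_spec. intros eps.
  rewrite (is_derive_within_spec D f x l (locally_singleton _ _ HD)) in H.
  destruct (H eps) as [d1 H1]. destruct HD as [d2 H2].
  assert (Hm : 0 < Rmin d1 d2) by (apply Rmin_glb_lt; apply cond_pos).
  exists (mkposreal _ Hm). simpl. intros y Hy.
  apply H1; [|apply H2]; eapply Rlt_le_trans;
    [exact Hy | apply Rmin_l | exact Hy | apply Rmin_r].
Qed.

Lemma is_derive_within_of_eq (D : R -> Prop) (f F : R -> R) (x b l : R) :
  D x -> x < b -> (forall y, D y -> y < b -> f y = F y) ->
  is_derive F x l -> is_derive_within D f x l.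
Proof.
  intros Dx Hb E H. apply is_derive_within_spec; [exact Dx|]. intros eps.
  destruct (proj1 (is_derive_spec F x l) H eps) as [d Hd].
  assert (Hm : 0 < Rmin d (b - x)) by (apply Rmin_glb_lt; [apply cond_pos | lra]).
  exists (mkposreal _ Hm). simpl. intros y Hy Dy.
  assert (A1 := Rmin_l d (b - x)). assert (A2 := Rmin_r d (b - x)).
  assert (A3 := Rle_abs (y - x)).
  rewrite !E by (try assumption; lra). apply Hd. lra.
Qed.

(** * Continuous extension of the data beyond their intervals *)

(** For [b >= 0] this is the retraction of the line onto [[0, b]]; composing with it extends a
    function by its end values. *)
Definition clamp (b x : R) : R := Rmax 0 (Rmin b x).

Lemma clamp_bounds (b x : R) : 0 <= b -> 0 <= clamp b x <= b.
Proof.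
  intros Hb. split; [apply Rmax_l | apply Rmax_lub; [exact Hb | apply Rmin_l]].
Qed.

Lemma clamp_id (b x : R) : 0 <= x <= b -> clamp b x = x.
Proof.
  intros [H1 H2]. unfold clamp. rewrite Rmin_right by exact H2. apply Rmax_right, H1.
Qed.

Lemma continuous1_Rabs : continuous1 Rabs.
Proof. intros x. apply continuous_Rabs. Qed.

Lemma continuous1_Rmax0 : continuous1 (Rmax 0).
Proof.
  intros x. apply (continuous_ext (fun x => (x + Rabs x) * / 2)).
  - intros y. unfold Rabs, Rmax. destruct Rcase_abs, Rle_dec; lra.
  - pose proof continuous1_Rabs. cont.
Qed.

Lemma continuous1_clamp (b : R) : continuous1 (clamp b).
Proof.
  intros x. pose proof continuous1_Rmax0 as HM.
  apply (continuous_ext (fun x => Rmax 0 (b - Rmax 0 (b - x)))).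
  - intros y. unfold clamp. f_equal. unfold Rmin, Rmax.
    destruct (Rle_dec 0 (b - y)), (Rle_dec b y); lra.
  - apply (continuous1_comp (Rmax 0) (fun x => b - Rmax 0 (b - x))); [exact HM|].
    apply continuous_Rminus; [cont|].
    apply (continuous1_comp (Rmax 0) (fun x => b - x)); [exact HM | cont].
Qed.

(** Since [r] takes all its values in [D], the restriction of neighbourhoods to [D] is no
    restriction along [r]. *)
Lemma continuous_on_retract {U V : UniformSpace} (D : U -> Prop) (u : U -> V) (r : U -> U) :
  (forall z, D (r z)) -> (forall z, continuous r z) -> continuous_on D u ->
  forall z, continuous (fun z => u (r z)) z.
Proof.
  intros HD Hr Hu z. apply (filterlim_comp _ _ _ r u _ (within D (locally (r z)))).
  - intros P HP. apply (filter_imp (fun x => D (r x) -> P (r x)) (fun x => P (r x))).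
    + intros x Hx. apply Hx, HD.
    + exact (Hr z _ HP).
  - apply Hu, HD.
Qed.

Lemma continuous2_clamp (L T b : R) (u : R -> R -> R) :
  0 <= L -> 0 <= b < T -> continuous_on_cylinder L T u ->
  continuous2 (fun x t => u (clamp L x) (clamp b t)).
Proof.
  intros HL Hb Hu.
  refine (continuous_on_retract _ (fun p : R * R => u (fst p) (snd p))
    (fun p : R * R => (clamp L (fst p), clamp b (snd p))) _ _ Hu).
  - intros z. simpl. assert (A1 := clamp_bounds L (fst z) HL).
    assert (A2 := clamp_bounds b (snd z) (proj1 Hb)).
    split; [exact A1 | split; [exact (proj1 A2)|]].
    exact (Rle_lt_trans _ _ _ (proj2 A2) (proj2 Hb)).
  - intros z. pose proof (continuous1_clamp L) as C1. pose proof (continuous1_clamp b) as C2.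
    apply (continuous_comp_2 (fun p : R * R => clamp L (fst p))
             (fun p : R * R => clamp b (snd p)) pair).
    + apply (continuous1_comp (clamp L) (fun p : R * R => fst p)); [exact C1 | cont].
    + apply (continuous1_comp (clamp b) (fun p : R * R => snd p)); [exact C2 | cont].
    + apply (continuous_ext (fun x => x)); [intros []; reflexivity | apply continuous_id].
Qed.

Lemma locally_open_interval (a b x : R) : a < x < b -> locally x (fun y => a < y < b).
Proof. intros Hx. apply (locally_interval _ x a b); simpl; tauto. Qed.

Lemma is_derive_clamp (D : R -> Prop) (f : R -> R) (b x l : R) :
  (forall y, 0 < y < b -> D y) -> 0 < x < b -> is_derive_within D f x l ->
  is_derive (fun y => f (clamp b y)) x l.
Proof.
  intros HD Hx H. assert (HL := locally_open_interval 0 b x Hx).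
  apply (is_derive_ext_loc f).
  - revert HL. apply filter_imp. intros y Hy. rewrite clamp_id by lra. reflexivity.
  - apply (is_derive_within_interior D); [|exact H].
    revert HL. apply filter_imp. exact HD.
Qed.

(** The fundamental theorem with differentiability in the open interval only, since clamped
    functions may have corners at the ends. The mean value theorem is applied to [F] minus the
    integral of [d]. *)
Lemma RInt_of_is_derive (F d : R -> R) (a b : R) :
  a <= b -> continuous1 F -> continuous1 d ->
  (forall x, a < x < b -> is_derive F x (d x)) -> RInt d a b = F b - F a.
Proof.
  intros Hab HF Hd HD.
  destruct (MVT_gen (fun x => F x - RInt d a x) a b (fun _ => 0)) as [c [_ Hc]].
  - intros x Hx. rewrite Rmin_left, Rmax_right in Hx by exact Hab.
    evar_last; [apply @is_derive_minus; [apply HD, Hx | apply is_derive_RInt_upper, Hd]|].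
    apply @minus_eq_zero.
  - intros x _. apply continuity_pt_filterlim.
    change (continuous (fun x => F x - RInt d a x) x). apply continuous_Rminus; [apply HF|].
    apply @ex_derive_continuous. eexists. apply is_derive_RInt_upper, Hd.
  - cbv beta in Hc. rewrite RInt_point in Hc. unfold zero in Hc; simpl in Hc. lra.
Qed.

(** Extending [N] by a constant could produce a corner at 0. Instead its derivative is extended by a
    constant to negative times and integrated from the value [N 0]. *)
Lemma kernel_extension (N N1 : R -> R) :
  C_k_on nonneg_half_line 3 N ->
  (forall t, 0 <= t -> is_derive_within nonneg_half_line N t (N1 t)) ->
  exists Ne N1e : R -> R,
    continuous1 N1e /\ (forall t, is_derive Ne t (N1e t)) /\
    (forall t, 0 <= t -> Ne t = N t) /\ (forall t, 0 <= t -> N1e t = N1 t).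
Proof.
  intros [d [Hd0 [Hd Hc]]] H1.
  assert (HR : forall x : R, 0 <= Rmax 0 x) by (intros; apply Rmax_l).
  assert (HR' : forall x : R, 0 <= x -> Rmax 0 x = x) by (intros; apply Rmax_right; assumption).
  (* The derivatives in [C_k_on] are only known to exist; uniqueness of the one-sided derivative
     identifies the first one with [N1]. *)
  assert (E1 : forall t, 0 <= t -> d 1%nat t = N1 t).
  { intros t Ht.
    apply (is_derive_within_unique nonneg_half_line (d 0%nat) t (t + 1)); [lra| | |].
    - intros y Hy. unfold nonneg_half_line. lra.
    - apply Hd; [lia | exact Ht].
    - apply is_derive_within_spec; [exact Ht|]. intros eps.
      destruct (proj1 (is_derive_within_spec nonneg_half_line N t (N1 t) Ht) (H1 t Ht) eps)
        as [r Hr].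
      exists r. intros y Hy Dy. rewrite !Hd0 by assumption. apply Hr; assumption. }
  assert (C1 : continuous1 (fun t => d 1%nat (Rmax 0 t))).
  { exact (continuous_on_retract nonneg_half_line (d 1%nat) (Rmax 0) HR
             continuous1_Rmax0 (Hc 1%nat ltac:(lia))). }
  assert (C0 : continuous1 (fun t => d 0%nat (Rmax 0 t))).
  { exact (continuous_on_retract nonneg_half_line (d 0%nat) (Rmax 0) HR
             continuous1_Rmax0 (Hc 0%nat ltac:(lia))). }
  exists (fun t => N 0 + RInt (fun r => d 1%nat (Rmax 0 r)) 0 t), (fun t => d 1%nat (Rmax 0 t)).
  split; [exact C1|]. split; [|split].
  - intros t. evar_last.
    + apply @is_derive_plus; [apply @is_derive_const|].
      apply (is_derive_RInt_upper (fun r => d 1%nat (Rmax 0 r))), C1.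
    + apply plus_zero_l.
  - intros t Ht.
    rewrite (RInt_of_is_derive (fun t => d 0%nat (Rmax 0 t)) (fun r => d 1%nat (Rmax 0 r)) 0 t Ht C0 C1).
    + rewrite !HR' by lra. rewrite !Hd0 by (unfold nonneg_half_line; lra). ring.
    + intros x Hx. rewrite HR' by lra.
      assert (HL := locally_open_interval 0 (x + 1) x ltac:(lra)).
      apply (is_derive_ext_loc (d 0%nat)).
      * revert HL. apply filter_imp. intros y Hy. rewrite HR' by lra. reflexivity.
      * apply (is_derive_within_interior nonneg_half_line).
        -- revert HL. apply filter_imp. intros y Hy. unfold nonneg_half_line. lra.
        -- apply Hd; [lia | unfold nonneg_half_line; lra].
  - intros t Ht. rewrite HR' by exact Ht. apply E1, Ht.
Qed.

(** * Convolution in time and the pairing [H_of] *)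

Lemma conv_ext (A B a c : R -> R) (t : R) :
  0 <= t -> (forall s, 0 <= s -> A s = B s) -> (forall s, 0 < s < t -> a s = c s) ->
  conv A a t = conv B c t.
Proof.
  intros Ht HA Ha. apply RInt_ext. intros s Hs.
  rewrite Rmin_left, Rmax_right in Hs by exact Ht.
  rewrite HA, Ha by lra. reflexivity.
Qed.

(** Convolutions acting on different variables commute, by exchange of the integrals over a
    rectangle. *)
Lemma conv_conv_swap (A B : R -> R) (J : R -> R -> R) (s t : R) :
  continuous1 A -> continuous1 B -> continuous2 J ->
  conv A (fun xi => conv B (fun nu => J nu xi) s) t = conv B (fun nu => conv A (J nu) t) s.
Proof.
  intros HA HB HJ. unfold conv.
  transitivity (RInt (fun xi => RInt (fun nu => A (t - xi) * (B (s - nu) * J nu xi)) 0 s) 0 t).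
  { apply RInt_ext. intros xi _. symmetry. apply (RInt_scal (fun nu => B (s - nu) * J nu xi)).
    apply ex_RInt_continuous1. cont. }
  rewrite (RInt_swap (fun xi nu => A (t - xi) * (B (s - nu) * J nu xi))) by cont.
  apply RInt_ext. intros nu _.
  transitivity (RInt (fun xi => scal (B (s - nu)) (A (t - xi) * J nu xi)) 0 t).
  { apply RInt_ext. intros xi _. unfold scal; simpl; unfold mult; simpl. ring. }
  apply (RInt_scal (fun xi => A (t - xi) * J nu xi)). apply ex_RInt_continuous1. cont.
Qed.

Lemma H_of_plus_r (L : R) (u v w : R -> R -> R) (s t : R) :
  continuous2 u -> continuous2 v -> continuous2 w ->
  H_of L u (fun x s => v x s + w x s) s t = H_of L u v s t + H_of L u w s t.
Proof.
  intros Hu Hv Hw. unfold H_of.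
  rewrite <- (RInt_plus (V := R_CompleteNormedModule) (fun x => u x t * v x s)
    (fun x => u x t * w x s)) by (apply ex_RInt_continuous1; cont).
  apply RInt_ext. intros x _. unfold plus; simpl. ring.
Qed.

Lemma H_of_sym (L : R) (u v : R -> R -> R) (s t : R) : H_of L u v s t = H_of L v u t s.
Proof. apply RInt_ext. intros; apply Rmult_comm. Qed.

Lemma H_of_conv_l (L : R) (A : R -> R) (a v : R -> R -> R) (s t : R) :
  continuous1 A -> continuous2 a -> continuous2 v ->
  H_of L (fun x => conv A (a x)) v s t = conv A (H_of L a v s) t.
Proof.
  intros HA Ha Hv. unfold H_of, conv.
  transitivity (RInt (fun x => RInt (fun r => A (t - r) * (a x r * v x s)) 0 t) 0 L).
  { apply RInt_ext. intros x _.
    transitivity (v x s * RInt (fun r => A (t - r) * a x r) 0 t); [apply Rmult_comm|].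
    transitivity (RInt (fun r => scal (v x s) (A (t - r) * a x r)) 0 t).
    - symmetry. apply (RInt_scal (fun r => A (t - r) * a x r)).
      apply ex_RInt_continuous1. cont.
    - apply RInt_ext. intros r _. unfold scal; simpl; unfold mult; simpl. ring. }
  rewrite (RInt_swap (fun x r => A (t - r) * (a x r * v x s))) by cont.
  apply RInt_ext. intros r _. apply (RInt_scal (fun x => a x r * v x s)).
  apply ex_RInt_continuous1. cont.
Qed.

Lemma H_of_conv_r (L : R) (A : R -> R) (u a : R -> R -> R) (s t : R) :
  continuous1 A -> continuous2 u -> continuous2 a ->
  H_of L u (fun x => conv A (a x)) s t = conv A (fun nu => H_of L u a nu t) s.
Proof.
  intros HA Hu Ha. rewrite H_of_sym, H_of_conv_l by assumption.
  apply RInt_ext. intros r _. rewrite H_of_sym. reflexivity.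
Qed.

Lemma is_derive_H_of_t (L : R) (u u' v : R -> R -> R) (s t : R) :
  (forall x t, is_derive (u x) t (u' x t)) ->
  continuous2 u -> continuous2 u' -> continuous2 v ->
  is_derive (H_of L u v s) t (H_of L u' v s t).
Proof.
  intros Hd Hu Hu' Hv.
  apply (is_derive_RInt_under (fun t x => u x t * v x s) (fun t x => u' x t * v x s)).
  - intros r x. apply (is_derive_ext (fun t => scal (v x s) (u x t))).
    + intros; apply Rmult_comm.
    + rewrite Rmult_comm. apply (is_derive_scal (u x)), Hd.
  - cont.
  - cont.
Qed.

Lemma is_derive_H_of_s (L : R) (u v v' : R -> R -> R) (s t : R) :
  (forall x t, is_derive (v x) t (v' x t)) ->
  continuous2 u -> continuous2 v -> continuous2 v' ->
  is_derive (fun s => H_of L u v s t) s (H_of L u v' s t).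
Proof.
  intros Hd Hu Hv Hv'.
  apply (is_derive_ext (fun s => H_of L v u t s)); [intros; apply H_of_sym|].
  rewrite H_of_sym. apply is_derive_H_of_t; assumption.
Qed.

Lemma is_derive_conv_param (A : R -> R) (K K' : R -> R -> R) (s t : R) :
  (forall s x, is_derive (fun s => K s x) s (K' s x)) ->
  continuous1 A -> continuous2 K -> continuous2 K' ->
  is_derive (fun s => conv A (K s) t) s (conv A (K' s) t).
Proof.
  intros Hd HA HK HK'.
  apply (is_derive_RInt_under (fun s x => A (t - x) * K s x) (fun s x => A (t - x) * K' s x)).
  - intros r x. apply (is_derive_scal (fun s => K s x)), Hd.
  - cont.
  - cont.
Qed.

(** * Solutions expressed through [a = w_xx + q w], and Green's formula *)

(** The equation and [w(x,0) = 0] express [w_t], [w] and, through [N 0 = 1], also [w_tt] by [a]. For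
    continuous [a] and an extended kernel these formulas make sense, and may be differentiated in
    time, at all real times. *)
Definition velocity (N : R -> R) (a : R -> R -> R) (x t : R) : R := conv N (a x) t.
Definition displacement (N : R -> R) (a : R -> R -> R) (x t : R) : R :=
  RInt (velocity N a x) 0 t.
Definition acceleration (N1 : R -> R) (a : R -> R -> R) (x t : R) : R :=
  a x t + conv N1 (a x) t.

Lemma continuous2_velocity (N : R -> R) (a : R -> R -> R) :
  continuous1 N -> continuous2 a -> continuous2 (velocity N a).
Proof. intros HN Ha. unfold velocity, conv. cont. Qed.

Lemma continuous2_displacement (N : R -> R) (a : R -> R -> R) :
  continuous1 N -> continuous2 a -> continuous2 (displacement N a).
Proof. intros HN Ha. unfold displacement, velocity, conv. cont. Qed.

Lemma continuous2_acceleration (N1 : R -> R) (a : R -> R -> R) :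
  continuous1 N1 -> continuous2 a -> continuous2 (acceleration N1 a).
Proof. intros HN Ha. unfold acceleration, conv. cont. Qed.

Lemma is_derive_displacement (N : R -> R) (a : R -> R -> R) (x t : R) :
  continuous1 N -> continuous2 a ->
  is_derive (displacement N a x) t (velocity N a x t).
Proof.
  intros HN Ha. apply (is_derive_RInt_upper (velocity N a x)).
  unfold velocity, conv. cont.
Qed.

Lemma is_derive_velocity (N N1 : R -> R) (a : R -> R -> R) (x t : R) :
  (forall t, is_derive N t (N1 t)) -> continuous1 N1 -> N 0 = 1 -> continuous2 a ->
  is_derive (velocity N a x) t (acceleration N1 a x t).
Proof.
  intros HN HN1 H0 Ha. unfold acceleration. rewrite <- (Rmult_1_l (a x t)), <- H0.
  apply (is_derive_conv N N1 (a x)); try assumption. cont.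
Qed.

(** The part [N1 * a] of the acceleration is a convolution in [s]. It can be taken out of the space
    integral and then past the convolution with [N] in [t]. *)
Lemma H_of_acceleration (L : R) (N N1 : R -> R) (u a : R -> R -> R) (s t : R) :
  continuous1 N -> continuous1 N1 -> continuous2 u -> continuous2 a ->
  let j s := conv N (H_of L u a s) t in
  conv N (H_of L u (acceleration N1 a) s) t = j s + conv N1 j s.
Proof.
  intros HN HN1 Hu Ha j. unfold j.
  assert (HJ : continuous2 (H_of L u a)) by (unfold H_of; cont).
  rewrite <- (conv_conv_swap N N1 (H_of L u a)) by assumption.
  rewrite <- conv_plus.
  - apply RInt_ext. intros xi _. f_equal. unfold acceleration at 1.
    rewrite (H_of_plus_r L u a (fun x => conv N1 (a x))) by (try assumption; unfold conv; cont).
    f_equal. apply H_of_conv_r; assumption.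
  - exact HN.
  - cont.
  - unfold conv. cont.
Qed.

(* [a] stands for [w_xx + q w] and [u] for [w], both extended continuously to the
   plane; the equation and the initial condition give [u = displacement N a]. *)
Record is_extension (L b : R) (q N f y : R -> R) (w a u ux : R -> R -> R) : Prop := {
  ext_continuous_a : continuous2 a;
  ext_continuous_u : continuous2 u;
  ext_continuous_ux : continuous2 ux;
  ext_derive_u : forall x t, 0 < x < L -> 0 < t < b ->
    is_derive (fun x => u x t) x (ux x t);
  ext_derive_ux : forall x t, 0 < x < L -> 0 < t < b ->
    is_derive (fun x => ux x t) x (a x t - q x * u x t);
  ext_displacement : forall x t, 0 < x < L -> 0 <= t <= b -> u x t = displacement N a x t;
  ext_w : forall x t, 0 < x < L -> 0 <= t <= b -> w x t = displacement N a x t;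
  ext_left : forall t, 0 < t < b -> u 0 t = f t;
  ext_right : forall t, 0 < t < b -> u L t = 0;
  ext_slope : forall t, 0 < t < b -> ux 0 t = y t
}.

(** [w], [w_x], [w_xx] and [q] are clamped to [[0, L]] in space and to [[0, b]] in time, and [a] is
    formed from the results. Uniqueness of the one-sided derivative identifies the clamped [w_x] at
    [x = 0] with [y]. *)
Lemma classical_solution_extension (L T b : R) (q N Ne f y : R -> R) (w : R -> R -> R) :
  0 < L -> 0 < b < T -> continuous_on (space_interval L) q ->
  continuous1 Ne -> (forall t, 0 <= t -> Ne t = N t) ->
  classical_solution L T q N f w -> is_boundary_slope L T w y ->
  exists a u ux, is_extension L b (fun x => q (clamp L x)) Ne f y w a u ux.
Proof.
  intros HL Hb Hq HN HNe [wt [wx [wxx [Cw [_ [Cwx [Cwxx [Hd [Heq [Hini [Hl Hr]]]]]]]]]]] Hy.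
  apply (continuous2_clamp L T b) in Cw; [|lra|lra].
  apply (continuous2_clamp L T b) in Cwx; [|lra|lra].
  apply (continuous2_clamp L T b) in Cwxx; [|lra|lra].
  assert (Cq : continuous1 (fun x => q (clamp L x))).
  { exact (continuous_on_retract (space_interval L) q (clamp L)
      (fun x => clamp_bounds L x (Rlt_le _ _ HL)) (continuous1_clamp L) Hq). }
  set (qe := fun x => q (clamp L x)) in *.
  set (u := fun x t => w (clamp L x) (clamp b t)) in *.
  set (ux := fun x t => wx (clamp L x) (clamp b t)) in *.
  set (uxx := fun x t => wxx (clamp L x) (clamp b t)) in *.
  assert (Eu : forall x t, 0 <= x <= L -> 0 <= t <= b -> u x t = w x t).
  { intros x t Hx Ht. unfold u. rewrite !clamp_id by assumption. reflexivity. }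
  set (a := fun x t => uxx x t + qe x * u x t).
  assert (Ca : continuous2 a) by (unfold a; cont).
  (* The equation and the initial condition are given for interior [x] only, which is enough inside
     integrals over [(0, L)]. *)
  assert (Eud : forall x t, 0 < x < L -> 0 <= t <= b -> u x t = displacement Ne a x t).
  { intros x t Hx Ht. unfold displacement.
    rewrite (RInt_of_is_derive (u x) (velocity Ne a x) 0 t); [|lra|cont| |].
    - rewrite (Eu x 0) by lra. rewrite Hini by exact Hx. ring.
    - unfold velocity, conv. cont.
    - intros r Hr'. unfold u. rewrite clamp_id by lra.
      apply (is_derive_clamp (time_interval T)); [unfold time_interval; intros; lra | lra|].
      replace (velocity Ne a x r) with (wt x r).
      + apply (Hd x r); [unfold space_interval; lra | unfold time_interval; lra].
      + rewrite Heq by lra.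
        apply (conv_ext N Ne (fun s => wxx x s + q x * w x s)).
        * lra.
        * intros; symmetry; apply HNe; assumption.
        * intros s Hs. unfold a, uxx, u, qe. rewrite !clamp_id by lra. reflexivity. }
  exists a, u, ux. constructor; try assumption.
  - intros x t Hx Ht. unfold u, ux. rewrite clamp_id by lra. rewrite clamp_id by lra.
    apply (is_derive_clamp (space_interval L) (fun x => w x t));
      [unfold space_interval; intros; lra | lra|].
    apply (Hd x t); [unfold space_interval; lra | unfold time_interval; lra].
  - intros x t Hx Ht. unfold a, ux.
    replace (uxx x t + qe x * u x t - qe x * u x t) with (uxx x t) by ring.
    unfold uxx. rewrite clamp_id by lra. rewrite clamp_id by lra.
    apply (is_derive_clamp (space_interval L) (fun x => wx x t));
      [unfold space_interval; intros; lra | lra|].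
    apply (Hd x t); [unfold space_interval; lra | unfold time_interval; lra].
  - intros x t Hx Ht. rewrite <- Eud by assumption. symmetry. apply Eu; lra.
  - intros t Ht. rewrite Eu by lra. apply Hl. lra.
  - intros t Ht. rewrite Eu by lra. apply Hr. lra.
  - intros t Ht. unfold ux. rewrite !clamp_id by lra.
    apply (is_derive_within_unique (space_interval L) (fun x => w x t) 0 L); [exact HL| | |].
    + unfold space_interval. intros; lra.
    + apply (Hd 0 t); [unfold space_interval; lra | unfold time_interval; lra].
    + apply Hy. lra.
Qed.

(** Lagrange's identity: [af ug - uf ag] is the [x]-derivative of [uxf ug - uf uxg], because the
    terms with [q] cancel. At [x = L] both [uf] and [ug] vanish, and at [x = 0] the data and slopes
    appear. The displacements are replaced by [uf] and [ug], for which derivatives in [x] and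
    boundary values are available. *)
Lemma green (L b : R) (q N f g yf yg : R -> R) (wf wg af ag uf ug uxf uxg : R -> R -> R)
    (s t : R) :
  0 < L -> 0 < s < b -> 0 < t < b -> continuous1 q -> continuous1 N ->
  is_extension L b q N f yf wf af uf uxf -> is_extension L b q N g yg wg ag ug uxg ->
  H_of L af (displacement N ag) s t =
  H_of L (displacement N af) ag s t + (f t * yg s - yf t * g s).
Proof.
  intros HL Hs Ht Hq HN Ef Eg.
  destruct Ef as [Caf Cuf Cuxf Duf Duxf Edf _ Elf Erf Esf].
  destruct Eg as [Cag Cug Cuxg Dug Duxg Edg _ Elg Erg Esg].
  assert (E1 : H_of L af (displacement N ag) s t = H_of L af ug s t).
  { apply RInt_ext. intros x Hx. rewrite Rmin_left, Rmax_right in Hx by lra.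
    rewrite Edg by lra. reflexivity. }
  assert (E2 : H_of L (displacement N af) ag s t = H_of L uf ag s t).
  { apply RInt_ext. intros x Hx. rewrite Rmin_left, Rmax_right in Hx by lra.
    rewrite Edf by lra. reflexivity. }
  rewrite E1, E2.
  assert (E : RInt (fun x => af x t * ug x s - uf x t * ag x s) 0 L
    = (uxf L t * ug L s - uf L t * uxg L s) - (uxf 0 t * ug 0 s - uf 0 t * uxg 0 s)).
  { apply (RInt_of_is_derive (fun x => uxf x t * ug x s - uf x t * uxg x s)); [lra|cont|cont|].
    intros x Hx. evar_last.
    - apply @is_derive_minus; apply is_derive_Rmult;
        [apply Duxf | apply Dug | apply Duf | apply Duxg]; assumption.
    - unfold minus, plus, opp; simpl. ring. }
  rewrite (RInt_minus (V := R_CompleteNormedModule) (fun x => af x t * ug x s)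
    (fun x => uf x t * ag x s)) in E by (apply ex_RInt_continuous1; cont).
  unfold minus, plus, opp in E; simpl in E.
  rewrite Erf, Erg, Elf, Elg, Esf, Esg in E by assumption.
  unfold H_of. lra.
Qed.

(** * The identity at times before [b] *)

Lemma RInt_ext_0 (f g : R -> R) (c : R) :
  0 <= c -> (forall x, 0 < x < c -> f x = g x) -> RInt f 0 c = RInt g 0 c.
Proof.
  intros Hc E. apply RInt_ext. intros x Hx.
  rewrite Rmin_left, Rmax_right in Hx by exact Hc. apply E, Hx.
Qed.

Lemma ex_RInt_ext_0 (f g : R -> R) (c : R) :
  0 <= c -> (forall x, 0 < x < c -> f x = g x) -> continuous1 g -> ex_RInt f 0 c.
Proof.
  intros Hc E Hg. apply (ex_RInt_ext g).
  - intros x Hx. rewrite Rmin_left, Rmax_right in Hx by exact Hc. symmetry; apply E, Hx.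
  - apply ex_RInt_continuous1, Hg.
Qed.

Lemma is_derive_ext_open (F M : R -> R) (b s l : R) :
  (forall s, 0 < s < b -> F s = M s) -> 0 < s < b -> is_derive M s l -> is_derive F s l.
Proof.
  intros E Hs. apply is_derive_ext_loc.
  generalize (locally_open_interval 0 b s Hs). apply filter_imp.
  intros y Hy. symmetry. apply E, Hy.
Qed.

(** The first derivative of [F] equals [M1] on the whole open interval and not just at [s], so it
    can be differentiated once more. *)
Lemma Derive_n_2_ext_open (F M M1 M2 : R -> R) (b s : R) :
  (forall s, 0 < s < b -> F s = M s) ->
  (forall s, is_derive M s (M1 s)) -> (forall s, is_derive M1 s (M2 s)) -> 0 < s < b ->
  (forall k, (k <= 2)%nat -> ex_derive_n F k s) /\ Derive_n F 2 s = M2 s.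
Proof.
  intros E H1 H2 Hs.
  assert (D1 : forall s, 0 < s < b -> is_derive F s (M1 s)).
  { intros r Hr. apply (is_derive_ext_open F M b); auto. }
  assert (D2 : is_derive (Derive F) s (M2 s)).
  { apply (is_derive_ext_open (Derive F) M1 b); [|exact Hs | apply H2].
    intros r Hr. apply is_derive_unique, D1, Hr. }
  split.
  - intros [|[|[|k]]] Hk; [exact I | | | lia].
    + eexists. apply D1, Hs.
    + eexists. exact D2.
  - exact (is_derive_unique _ _ _ D2).
Qed.

Lemma displacement_0 (N : R -> R) (a : R -> R -> R) (x : R) : displacement N a x 0 = 0.
Proof. exact (RInt_point 0 _). Qed.

Lemma velocity_0 (N : R -> R) (a : R -> R -> R) (x : R) : velocity N a x 0 = 0.
Proof. exact (RInt_point 0 _). Qed.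

Lemma test_function_continuous1 (T : R) (f : R -> R) : test_function T f -> continuous1 f.
Proof. intros [Hf _] x. apply @ex_derive_continuous. exact (Hf 1%nat x). Qed.

(** For times in [(0, b)] every term equals its counterpart formed from the extensions. Those are
    continuous everywhere, which gives existence of all integrals and derivatives, and the identity
    is then proved for them. *)
Lemma identity_before (L b : R) (q N Res Ne N1e Rese f g yf yg : R -> R)
    (wf wg af ag uf ug uxf uxg : R -> R -> R) (s t : R) :
  0 < L -> 0 < s < b -> 0 < t < b -> continuous1 q -> continuous1 f -> continuous1 g ->
  continuous1 N1e -> continuous1 Rese -> (forall t, is_derive Ne t (N1e t)) ->
  (forall t, 0 <= t -> Ne t = N t) -> (forall t, 0 <= t -> Rese t = Res t) ->
  Ne 0 = 1 -> (forall t, 0 <= t -> Rese t + conv N1e Rese t = N1e t) ->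
  is_extension L b q Ne f yf wf af uf uxf -> is_extension L b q Ne g yg wg ag ug uxg ->
  let H := H_of L wf wg in
  let Phi := Phi_of N f g yf yg in
  let Psi := Psi_of N Phi in
  let F := F_of Res Psi in
  terms_exist L N Res f g yf yg wf wg s t /\
  Derive (fun t' => H s t') t =
    Derive_n (fun s' => RInt (fun xi => N (t - xi) * H s' xi) 0 t) 2 s
    - RInt (fun nu => Res (s - nu) *
        RInt (fun xi => N (t - xi) * Derive_n (fun nu' => H nu' xi) 2 nu) 0 t) 0 s
    + F s t.
Proof.
  intros HL Hs Ht Cq Cf Cg CN1 CR DN EN ER HN0 Hres Ef Eg H Phi Psi F.
  assert (CN : continuous1 Ne).
  { intros x. apply @ex_derive_continuous. eexists; apply DN. }
  assert (Green := fun r p Hr Hp => green L b q Ne f g yf yg wf wg af ag uf ug uxf uxg r p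
                     HL Hr Hp Cq CN Ef Eg).
  destruct Ef as [Caf _ Cuxf _ _ _ Ewf _ _ Esf].
  destruct Eg as [Cag _ Cuxg _ _ _ Ewg _ _ Esg].
  set (U := displacement Ne af) in *. set (V := displacement Ne ag) in *.
  assert (CU : continuous2 U) by (apply continuous2_displacement; assumption).
  assert (CV : continuous2 V) by (apply continuous2_displacement; assumption).
  assert (CVt : continuous2 (velocity Ne ag)) by (apply continuous2_velocity; assumption).
  assert (CUt : continuous2 (velocity Ne af)) by (apply continuous2_velocity; assumption).
  assert (CVtt : continuous2 (acceleration N1e ag)) by (apply continuous2_acceleration; assumption).
  (* [K], [K1] and [K2] play the roles of [H], [H_s] and [H_ss]. *)
  set (K := H_of L U V).
  set (K1 := H_of L U (velocity Ne ag)).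
  set (K2 := H_of L U (acceleration N1e ag)).
  assert (CK : continuous2 K) by (unfold K, H_of; cont).
  assert (CK1 : continuous2 K1) by (unfold K1, H_of; cont).
  assert (CK2 : continuous2 K2) by (unfold K2, H_of; cont).
  assert (DK : forall s x, is_derive (fun s => K s x) s (K1 s x)).
  { intros r x. apply is_derive_H_of_s; try assumption.
    intros; apply is_derive_displacement; assumption. }
  assert (DK1 : forall s x, is_derive (fun s => K1 s x) s (K2 s x)).
  { intros r x. apply is_derive_H_of_s; try assumption.
    intros; apply (is_derive_velocity Ne N1e); assumption. }
  assert (EH : forall s t, 0 < s < b -> 0 < t < b -> H s t = K s t).
  { intros r p Hr Hp. apply RInt_ext_0; [lra|].
    intros x Hx. rewrite Ewf, Ewg by lra. reflexivity. }
  assert (ENt : forall t r, 0 < r < t -> N (t - r) = Ne (t - r)).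
  { intros p r Hr. symmetry. apply EN. lra. }
  (* [phi] is [Phi] at the fixed [t], with [yf] and [yg] replaced by the continuous functions
     [uxf 0] and [uxg 0]. *)
  set (phi := fun s => conv Ne (fun r => f r * uxg 0 s - uxf 0 r * g s) t).
  assert (Cphi : continuous1 phi) by (unfold phi, conv; cont).
  assert (EPhi : forall s, 0 < s < b -> Phi s t = phi s).
  { intros r Hr. unfold Phi, Phi_of, phi, conv. apply RInt_ext_0; [lra|].
    intros p Hp. rewrite ENt, Esg, Esf by lra. reflexivity. }
  assert (EPsi : forall s, 0 < s < b -> Psi s t = conv Ne phi s).
  { intros r Hr. unfold Psi, Psi_of, conv. apply RInt_ext_0; [lra|].
    intros p Hp. rewrite ENt, EPhi by lra. reflexivity. }
  assert (DPsi : forall s, 0 < s < b ->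
    is_derive (fun s => Psi s t) s (phi s + conv N1e phi s)).
  { intros r Hr. apply (is_derive_ext_open _ (conv Ne phi) b); [exact EPsi | exact Hr|].
    rewrite <- (Rmult_1_l (phi r)), <- HN0.
    apply (is_derive_conv Ne N1e); assumption. }
  assert (EDPsi : forall s, 0 < s < b ->
    Derive (fun s => Psi s t) s = phi s + conv N1e phi s).
  { intros r Hr. apply is_derive_unique, DPsi, Hr. }
  assert (DKn := fun s x (Hx : 0 < x < b) => Derive_n_2_ext_open
    (fun s => H s x) (fun s => K s x) (fun s => K1 s x) (fun s => K2 s x) b s
    (fun s Hs => EH s x Hs Hx) (fun s => DK s x) (fun s => DK1 s x)).
  assert (EM : forall s, 0 < s < b ->
    RInt (fun xi => N (t - xi) * H s xi) 0 t = conv Ne (K s) t).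
  { intros r Hr. apply RInt_ext_0; [lra|]. intros x Hx. rewrite ENt, EH by lra. reflexivity. }
  assert (DM := Derive_n_2_ext_open (fun s => RInt (fun xi => N (t - xi) * H s xi) 0 t)
    (fun s => conv Ne (K s) t) (fun s => conv Ne (K1 s) t) (fun s => conv Ne (K2 s) t) b s EM
    (fun s => is_derive_conv_param Ne K K1 s t DK CN CK CK1)
    (fun s => is_derive_conv_param Ne K1 K2 s t DK1 CN CK1 CK2) Hs).
  assert (EM2 : forall s, 0 < s < b ->
    RInt (fun xi => N (t - xi) * Derive_n (fun nu => H nu xi) 2 s) 0 t = conv Ne (K2 s) t).
  { intros r Hr. apply RInt_ext_0; [lra|]. intros x Hx.
    rewrite ENt by lra. f_equal. exact (proj2 (DKn r x ltac:(lra) Hr)). }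
  assert (Ht' : is_derive (fun t => H s t) t (H_of L (velocity Ne af) V s t)).
  { apply (is_derive_ext_open _ (K s) b); [|exact Ht|].
    - intros p Hp. apply EH; assumption.
    - apply is_derive_H_of_t; try assumption.
      intros; apply is_derive_displacement; assumption. }
  assert (EHt : Derive (fun t => H s t) t = H_of L (velocity Ne af) V s t)
    by exact (is_derive_unique _ _ _ Ht').
  assert (CM2 : continuous1 (fun nu => conv Ne (K2 nu) t)) by (unfold conv; cont).
  assert (EM2' : forall nu, 0 < nu < s -> Res (s - nu) *
      RInt (fun xi => N (t - xi) * Derive_n (fun nu' => H nu' xi) 2 nu) 0 t
      = Rese (s - nu) * conv Ne (K2 nu) t).
  { intros nu Hnu. rewrite EM2, ER by lra. reflexivity. }
  assert (Edphi : forall nu, 0 < nu < s -> Res (s - nu) * Derive (fun nu' => Psi nu' t) nu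
      = Rese (s - nu) * (phi nu + conv N1e phi nu)).
  { intros nu Hnu. rewrite EDPsi, ER by lra.
    reflexivity. }
  split.
  - repeat apply conj.
    + apply (ex_RInt_ext_0 _ (fun x => U x t * V x s)); [lra | | cont].
      intros x Hx. rewrite Ewf, Ewg by lra. reflexivity.
    + eexists. exact Ht'.
    + apply (ex_RInt_ext_0 _ (fun xi => Ne (t - xi) * K s xi)); [lra | | cont].
      intros x Hx. fold H. rewrite ENt, EH by lra. reflexivity.
    + exact (proj1 DM).
    + exact (proj1 (DKn s t Ht Hs)).
    + apply (ex_RInt_ext_0 _ (fun xi => Ne (t - xi) * K2 s xi)); [lra | | cont].
      intros x Hx. rewrite ENt by lra. f_equal. exact (proj2 (DKn s x ltac:(lra) Hs)).
    + apply (ex_RInt_ext_0 _ (fun nu => Rese (s - nu) * conv Ne (K2 nu) t));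
        [lra | exact EM2' | cont].
    + apply (ex_RInt_ext_0 _ (fun r => Ne (t - r) * (f r * uxg 0 s - uxf 0 r * g s)));
        [lra | | cont].
      intros x Hx. rewrite ENt, Esg, Esf by lra. reflexivity.
    + apply (ex_RInt_ext_0 _ (fun r => Ne (s - r) * phi r)); [lra | | cont].
      intros x Hx. fold Phi. rewrite ENt, EPhi by lra. reflexivity.
    + eexists. exact (DPsi s Hs).
    + apply (ex_RInt_ext_0 _ (fun nu => Rese (s - nu) * (phi nu + conv N1e phi nu)));
        [lra | exact Edphi | unfold conv; cont].
  - rewrite EHt, (proj2 DM).
    rewrite (RInt_ext_0 _ _ s ltac:(lra) EM2').
    unfold F, F_of. rewrite (EDPsi s Hs).
    rewrite (RInt_ext_0 _ _ s ltac:(lra) Edphi).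
    set (j := fun s => conv Ne (H_of L U ag s) t).
    assert (Cj : continuous1 j) by (unfold j, conv, H_of; cont).
    assert (EK2 : forall s, conv Ne (K2 s) t = j s + conv N1e j s).
    { intros r. apply H_of_acceleration; assumption. }
    (* The left side becomes this sum by Green's formula under the convolution with [Ne]; on the
       right the resolvent recovers [j] from [j + N1e * j] and [phi] from [phi + N1e * phi]. *)
    transitivity (j s + phi s).
    + unfold velocity. rewrite H_of_conv_l by assumption. unfold j, phi.
      rewrite <- conv_plus by (try assumption; unfold H_of; cont).
      apply conv_ext; [lra | reflexivity|].
      intros p Hp. rewrite Green, Esg, Esf by lra. reflexivity.
    + rewrite <- (resolvent_inverse N1e Rese j s) by (try assumption; lra).
      rewrite <- (resolvent_inverse N1e Rese phi s) at 1 by (try assumption; lra).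
      rewrite EK2. unfold conv at 3 6.
      replace (RInt (fun nu => Rese (s - nu) * conv Ne (K2 nu) t) 0 s)
        with (conv Rese (fun s => j s + conv N1e j s) s).
      * unfold conv. ring.
      * apply conv_ext; [lra | reflexivity|]. intros r _. symmetry. apply EK2.
Qed.

(** * The identity at all times before [T], and the initial values *)

Theorem mainTheorem1 (L : R) (q N N1 Res : R -> R)
  (HL : 0 < L)
  (Hq : continuous_on (space_interval L) q)
  (HN : C_k_on nonneg_half_line 3 N)
  (HN0 : N 0 = 1)
  (HN1 : forall t, 0 <= t -> is_derive_within nonneg_half_line N t (N1 t))
  (HRes : is_resolvent N1 Res)
  (T : R) (f g : R -> R)
  (HT : 0 < T)
  (Hf : test_function T f)
  (Hg : test_function T g)
  (wf wg : R -> R -> R)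
  (Hwf : classical_solution L T q N f wf)
  (Hwg : classical_solution L T q N g wg)
  (yf yg : R -> R)
  (Hyf : is_boundary_slope L T wf yf)
  (Hyg : is_boundary_slope L T wg yg) :
  let H := H_of L wf wg in
  let Phi := Phi_of N f g yf yg in
  let Psi := Psi_of N Phi in
  let F := F_of Res Psi in
  (forall s t, 0 < s < T -> 0 < t < T ->
     terms_exist L N Res f g yf yg wf wg s t /\
     Derive (fun t' => H s t') t =
       Derive_n (fun s' => RInt (fun xi => N (t - xi) * H s' xi) 0 t) 2 s
       - RInt (fun nu => Res (s - nu) *
           RInt (fun xi => N (t - xi) * Derive_n (fun nu' => H nu' xi) 2 nu) 0 t) 0 s
       + F s t) /\
  (forall s t, 0 <= s < T -> 0 <= t < T ->
     H 0 t = 0 /\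
     H s 0 = 0 /\
     is_derive_within (time_interval T) (fun t' => H s t') 0 0 /\
     is_derive_within (time_interval T) (fun s' => H s' t) 0 0).
Proof.
  intros H Phi Psi F.
  destruct (kernel_extension N N1 HN HN1) as [Ne [N1e [CN1 [DN [EN EN1]]]]].
  assert (CN : continuous1 Ne).
  { intros x. apply @ex_derive_continuous. eexists; apply DN. }
  (* Regularity is available up to any time before [T], so [b] is taken midway between [T] and the
     largest of 0, [s] and [t]. *)
  assert (Ex : forall s t, s < T -> t < T -> exists b, 0 < b < T /\ s < b /\ t < b).
  { intros s t Hs Ht. exists ((Rmax 0 (Rmax s t) + T) / 2).
    assert (Rmax 0 (Rmax s t) < T) by (repeat apply Rmax_lub_lt; assumption).
    assert (A1 := Rmax_l 0 (Rmax s t)). assert (A2 := Rmax_r 0 (Rmax s t)).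
    assert (A3 := Rmax_l s t). assert (A4 := Rmax_r s t). lra. }
  split.
  - intros s t Hs Ht. destruct (Ex s t (proj2 Hs) (proj2 Ht)) as [b [Hb [Hsb Htb]]].
    destruct (classical_solution_extension L T b q N Ne f yf wf HL Hb Hq CN EN Hwf Hyf)
      as [af [uf [uxf Ef]]].
    destruct (classical_solution_extension L T b q N Ne g yg wg HL Hb Hq CN EN Hwg Hyg)
      as [ag [ug [uxg Eg]]].
    destruct HRes as [CRes ERes].
    assert (ERe : forall t, 0 <= t -> Res (Rmax 0 t) = Res t).
    { intros r Hr. rewrite Rmax_right by exact Hr. reflexivity. }
    apply (identity_before L b (fun x => q (clamp L x)) N Res Ne N1e
      (fun t => Res (Rmax 0 t)) f g yf yg wf wg af ag uf ug uxf uxg s t); try assumption; try lra.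
    + exact (continuous_on_retract (space_interval L) q (clamp L)
        (fun x => clamp_bounds L x (Rlt_le _ _ HL)) (continuous1_clamp L) Hq).
    + exact (test_function_continuous1 T f Hf).
    + exact (test_function_continuous1 T g Hg).
    + exact (continuous_on_retract nonneg_half_line Res (Rmax 0) (fun x => Rmax_l 0 x)
        continuous1_Rmax0 CRes).
    + rewrite EN by lra. exact HN0.
    (* At times [r >= 0] the convolution evaluates both kernels at nonnegative arguments only, so
       the Volterra equation passes to the extensions. *)
    + intros r Hr. rewrite EN1, ERe, <- (ERes r) by exact Hr. f_equal.
      apply conv_ext; [exact Hr | exact EN1|].
      intros p Hp. apply ERe. lra.
  - intros s t Hs Ht. destruct (Ex s t (proj2 Hs) (proj2 Ht)) as [b [Hb [Hsb Htb]]].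
    destruct (classical_solution_extension L T b q N Ne f yf wf HL Hb Hq CN EN Hwf Hyf)
      as [af [uf [uxf Ef]]].
    destruct (classical_solution_extension L T b q N Ne g yg wg HL Hb Hq CN EN Hwg Hyg)
      as [ag [ug [uxg Eg]]].
    destruct Ef as [Caf _ _ _ _ _ Ewf _ _ _]. destruct Eg as [Cag _ _ _ _ _ Ewg _ _ _].
    assert (CU : continuous2 (displacement Ne af)) by (apply continuous2_displacement; assumption).
    assert (CV : continuous2 (displacement Ne ag)) by (apply continuous2_displacement; assumption).
    assert (CUt : continuous2 (velocity Ne af)) by (apply continuous2_velocity; assumption).
    assert (CVt : continuous2 (velocity Ne ag)) by (apply continuous2_velocity; assumption).
    assert (EH : forall s t, 0 <= s <= b -> 0 <= t <= b ->
      H s t = H_of L (displacement Ne af) (displacement Ne ag) s t).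
    { intros r p Hr Hp. apply RInt_ext_0; [lra|].
      intros x Hx. rewrite Ewf, Ewg by lra. reflexivity. }
    assert (D0 : time_interval T 0) by (unfold time_interval; lra).
    assert (Z : forall u v s t, (forall x, u x t * v x s = 0) -> H_of L u v s t = 0).
    { intros u v r p E. rewrite <- (RInt_const0 0 L).
      apply RInt_ext. intros; apply E. }
    split; [|split; [|split]].
    + rewrite EH by lra. apply Z. intros x. rewrite (displacement_0 Ne ag). ring.
    + rewrite EH by lra. apply Z. intros x. rewrite (displacement_0 Ne af). ring.
    (* The one-sided derivative at 0 is the ordinary derivative of the extended pairing, which is
       zero because the velocity vanishes at time 0. *)
    + apply (is_derive_within_of_eq (time_interval T) (fun t' => H s t')
        (H_of L (displacement Ne af) (displacement Ne ag) s) 0 b); [exact D0 | lra | |].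
      * unfold time_interval. intros p Hp1 Hp2. apply EH; lra.
      * evar_last.
        -- apply (is_derive_H_of_t L _ (velocity Ne af)); try assumption.
           intros; apply is_derive_displacement; assumption.
        -- apply Z. intros x. rewrite velocity_0. ring.
    + apply (is_derive_within_of_eq (time_interval T) (fun s' => H s' t)
        (fun s => H_of L (displacement Ne af) (displacement Ne ag) s t) 0 b); [exact D0 | lra | |].
      * unfold time_interval. intros p Hp1 Hp2. apply EH; lra.
      * evar_last.
        -- apply (is_derive_H_of_s L _ _ (velocity Ne ag)); try assumption.
           intros; apply is_derive_displacement; assumption.
        -- apply Z. intros x. rewrite (velocity_0 Ne ag). ring.
Qed.
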